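(* For every projective formula $\varphi(x)$ (a formula of second-order arithmetic, evaluated in the standard model of second-order arithmetic with all subsets of $\mathbb{N}$), there is a formula $\varphi^*(x)$ of the full extension-potentialist language of arithmetic such that for every model $M\models\mathrm{PA}^+$ and every real $a\subseteq\mathbb{N}$ in the standard system of $M$, coded by $\bar a\in M$, $\varphi(a)$ holds if and only if $M\models\varphi^*(\bar a)$.
   Context: Fix a consistent computably enumerable theory $\mathrm{PA}^+$ extending $\mathrm{PA}$. For $M\models\mathrm{PA}^+$, $M\models\Diamond^{\mathrm{ext}}\psi$ iff $\psi$ holds in some extension $N\supseteq M$ with $N\models\mathrm{PA}^+$, and $\Box^{\mathrm{ext}}$ is dual. The full extension-potentialist language is the closure of the language of arithmetic under Boolean connectives, number quantifiers and $\Diamond^{\mathrm{ext}},\Box^{\mathrm{ext}}$ (which may occur under quantifiers). An element $\bar a\in M$ codes the set $a=\{k\in\mathbb{N}: M\models k\in\bar a\}$ (via the standard arithmetic coding of finite sets, e.g. binary expansion); the standard system $\mathrm{SSy}(M)$ is the collection of subsets of $\mathbb{N}$ so coded. *)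

(* Defs.v *)
(* Formulas are well-scoped de Bruijn terms: [form n] is the type of formulas
   whose free variables are in 'I_n. *)
From mathcomp Require Import all_boot.
Set Implicit Arguments.
Unset Strict Implicit.
Unset Printing Implicit Defensive.

(** * Assignments *)

Definition snil {X : Type} : 'I_0 -> X.
Proof. by case. Defined.

Definition scons {X : Type} {n : nat} (x : X) (v : 'I_n -> X) : 'I_n.+1 -> X :=
  fun i => if unlift ord0 i is Some j then v j else x.

(** * First-order arithmetic in the language 0, 1, +, *, < *)

Inductive term (n : nat) : Type :=
| Var (i : 'I_n)
| Zero
| One
| Add (s t : term n)
| Mul (s t : term n).
Arguments Zero {n}.
Arguments One {n}.

(* In [All p], the bound variable is variable 0 of [p], and variable i of
   [All p] is variable i.+1 of [p]. *)
Inductive form (n : nat) : Type :=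
| Bot
| Equ (s t : term n)
| Less (s t : term n)
| Imp (p q : form n)
| All (p : form n.+1).
Arguments Bot {n}.

Definition Neg n (p : form n) : form n := Imp p Bot.
Definition And n (p q : form n) : form n := Neg (Imp p (Neg q)).
Definition Iff n (p q : form n) : form n := And (Imp p q) (Imp q p).
Definition Ex n (p : form n.+1) : form n := Neg (All (Neg p)).

Local Notation x0 := (Var ord0).
Local Notation x1 := (Var (lift ord0 ord0)).
Local Notation x2 := (Var (lift ord0 (lift ord0 ord0))).

Fixpoint subst_term n m (sigma : 'I_n -> term m) (t : term n) : term m :=
  match t with
  | Var i => sigma i
  | Zero => Zero
  | One => One
  | Add s t => Add (subst_term sigma s) (subst_term sigma t)
  | Mul s t => Mul (subst_term sigma s) (subst_term sigma t)
  end.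

Definition shift_term n (t : term n) : term n.+1 :=
  subst_term (fun i => Var (lift ord0 i)) t.

Definition up n m (sigma : 'I_n -> term m) : 'I_n.+1 -> term m.+1 :=
  scons x0 (fun i => shift_term (sigma i)).

Fixpoint subst n m (sigma : 'I_n -> term m) (p : form n) : form m :=
  match p in form _ return form m with
  | Bot => Bot
  | Equ s t => Equ (subst_term sigma s) (subst_term sigma t)
  | Less s t => Less (subst_term sigma s) (subst_term sigma t)
  | Imp p q => Imp (subst sigma p) (subst sigma q)
  | All p => All (subst (up sigma) p)
  end.

Definition shift n (p : form n) : form n.+1 :=
  subst (fun i => Var (lift ord0 i)) p.

Definition inst n (t : term n) (p : form n.+1) : form n :=
  subst (scons t (@Var n)) p.

Fixpoint univ_closure n : form n -> form 0 :=
  match n with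
  | 0 => fun p => p
  | n'.+1 => fun p => univ_closure (All p)
  end.

Definition theory : Type := form 0 -> Prop.

(** * Provability: classical natural deduction with equality *)

Inductive prv : forall n, (form n -> Prop) -> form n -> Prop :=
| prv_ax n (G : form n -> Prop) p : G p -> prv G p
| prv_impI n (G : form n -> Prop) p q :
    prv (fun r => G r \/ r = p) q -> prv G (Imp p q)
| prv_impE n (G : form n -> Prop) p q : prv G (Imp p q) -> prv G p -> prv G q
| prv_raa n (G : form n -> Prop) p :
    prv (fun r => G r \/ r = Neg p) Bot -> prv G p
| prv_allI n (G : form n -> Prop) (p : form n.+1) :
    prv (fun r => exists2 q, G q & r = shift q) p -> prv G (All p)
| prv_allE n (G : form n -> Prop) (p : form n.+1) t :
    prv G (All p) -> prv G (inst t p)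
| prv_refl n (G : form n -> Prop) t : prv G (Equ t t)
| prv_leibniz n (G : form n -> Prop) (p : form n.+1) s t :
    prv G (Equ s t) -> prv G (inst s p) -> prv G (inst t p).

Definition consistent (T : theory) : Prop := ~ prv T Bot.

Definition extends (T S : theory) : Prop := forall p, S p -> prv T p.

(** * Peano arithmetic *)

(* In the induction scheme, variable 0 of [p] is the induction variable and
   the other ones are parameters. *)
Inductive PA : theory :=
| PA_succ_neq0 : PA (All (Neg (Equ (Add x0 One) Zero)))
| PA_succ_inj :
    PA (All (All (Imp (Equ (Add x1 One) (Add x0 One)) (Equ x1 x0))))
| PA_zero_add : PA (All (Equ (Add Zero x0) x0))
| PA_add_zero : PA (All (Equ (Add x0 Zero) x0))
| PA_add_succ :
    PA (All (All (Equ (Add x1 (Add x0 One)) (Add (Add x1 x0) One))))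
| PA_mul_zero : PA (All (Equ (Mul x0 Zero) Zero))
| PA_mul_succ :
    PA (All (All (Equ (Mul x1 (Add x0 One)) (Add (Mul x1 x0) x1))))
| PA_less :
    PA (All (All (Iff (Less x1 x0) (Ex (Equ (Add x2 (Add x0 One)) x1)))))
| PA_induction n (p : form n.+1) :
    PA (univ_closure
      (Imp (inst Zero p)
      (Imp (All (Imp p (subst (scons (Add x0 One)
                                     (fun i => Var (lift ord0 i))) p)))
           (All p)))).

(** * Computable enumerability *)

Inductive recf : nat -> Type :=
| RZero : recf 0
| RSucc : recf 1
| RProj n (i : 'I_n) : recf n
| RComp n m (f : recf m) (g : 'I_m -> recf n) : recf n
| RPrec n (f : recf n) (g : recf n.+2) : recf n.+1
| RMin n (f : recf n.+1) : recf n.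

(* [reval f v y]: the partial recursive function f is defined at v, with
   value y.  In the clause for primitive recursion, the recursion argument is
   argument 0 and s is the sequence of intermediate values. *)
Fixpoint reval n (f : recf n) : ('I_n -> nat) -> nat -> Prop :=
  match f in recf n return ('I_n -> nat) -> nat -> Prop with
  | RZero => fun _ y => y = 0
  | RSucc => fun v y => y = (v ord0).+1
  | RProj _ i => fun v y => y = v i
  | RComp n m f g => fun v y =>
      exists w : 'I_m -> nat, (forall i, reval (g i) v (w i)) /\ reval f w y
  | RPrec n f g => fun v y =>
      let u : 'I_n -> nat := fun i => v (lift ord0 i) in
      exists s : nat -> nat,
        [/\ reval f u (s 0),
            forall i, i < v ord0 -> reval g (scons i (scons (s i) u)) (s i.+1)
          & y = s (v ord0)]
  | RMin n f => fun v y =>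
      reval f (scons y v) 0 /\
      forall i, i < y -> exists z, reval f (scons i v) z.+1
  end.

Definition ce (A : nat -> Prop) : Prop :=
  exists f : recf 1, forall k, A k <-> exists y, reval f (scons k snil) y.

(* Cantor's pairing function. *)
Definition cpair (x y : nat) : nat := 'C((x + y).+1, 2) + y.

Fixpoint code_term n (t : term n) : nat :=
  match t with
  | Var i => cpair 0 i
  | Zero => cpair 1 0
  | One => cpair 2 0
  | Add s t => cpair 3 (cpair (code_term s) (code_term t))
  | Mul s t => cpair 4 (cpair (code_term s) (code_term t))
  end.

Fixpoint code n (p : form n) : nat :=
  match p with
  | Bot => cpair 0 0
  | Equ s t => cpair 1 (cpair (code_term s) (code_term t))
  | Less s t => cpair 2 (cpair (code_term s) (code_term t))
  | Imp p q => cpair 3 (cpair (code p) (code q))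
  | All p => cpair 4 (code p)
  end.

Definition ce_theory (T : theory) : Prop :=
  ce (fun k => exists2 p, T p & code p = k).

(** * Structures and satisfaction *)

Record structure : Type := Structure {
  carrier :> Type;
  zeroS : carrier;
  oneS : carrier;
  addS : carrier -> carrier -> carrier;
  mulS : carrier -> carrier -> carrier;
  lessS : carrier -> carrier -> Prop }.
Arguments zeroS {s}.
Arguments oneS {s}.

Fixpoint eval (M : structure) n (e : 'I_n -> M) (t : term n) : M :=
  match t with
  | Var i => e i
  | Zero => zeroS
  | One => oneS
  | Add s t => addS (eval e s) (eval e t)
  | Mul s t => mulS (eval e s) (eval e t)
  end.

Fixpoint sat (M : structure) n (e : 'I_n -> M) (p : form n) : Prop :=
  match p with
  | Bot => False
  | Equ s t => eval e s = eval e t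
  | Less s t => lessS (eval e s) (eval e t)
  | Imp p q => sat e p -> sat e q
  | All p => forall x : M, sat (scons x e) p
  end.

Definition models (T : theory) (M : structure) : Prop :=
  forall p, T p -> sat (M := M) snil p.

Record embedding (M N : structure) (f : M -> N) : Prop := Embedding {
  emb_inj : injective f;
  emb_zero : f zeroS = zeroS;
  emb_one : f oneS = oneS;
  emb_add : forall x y, f (addS x y) = addS (f x) (f y);
  emb_mul : forall x y, f (mulS x y) = mulS (f x) (f y);
  emb_less : forall x y, lessS x y <-> lessS (f x) (f y) }.

(** * The extension-potentialist language *)

Inductive pform (n : nat) : Type :=
| PArith (p : form n)
| PImp (p q : pform n)
| PAll (p : pform n.+1)
| Dia (p : pform n)
| Box (p : pform n).

(* An extension of M is given up to isomorphism, as a structure N together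
   with an embedding f of M in N; parameters are carried along f. *)
Fixpoint psat (T : theory) (M : structure) n (e : 'I_n -> M) (p : pform n) : Prop :=
  match p with
  | PArith p => sat e p
  | PImp p q => psat T e p -> psat T e q
  | PAll p => forall x : M, psat T (scons x e) p
  | Dia p => exists (N : structure) (f : M -> N),
      [/\ embedding f, models T N & psat T (fun i => f (e i)) p]
  | Box p => forall (N : structure) (f : M -> N),
      embedding f -> models T N -> psat T (fun i => f (e i)) p
  end.

(** * Second-order arithmetic in its standard model *)

(* [sform n m]: formulas with n free number variables and m free set
   variables. *)
Inductive sform (n m : nat) : Type :=
| SBot
| SEqu (s t : term n)
| SLess (s t : term n)
| SIn (t : term n) (X : 'I_m)
| SImp (p q : sform n m)
| SAllNum (p : sform n.+1 m)
| SAllSet (p : sform n m.+1).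

Definition natS : structure := Structure 0 1 addn muln (fun x y : nat => x < y).

Fixpoint ssat n m (e : 'I_n -> natS) (E : 'I_m -> nat -> Prop) (p : sform n m) :
    Prop :=
  match p with
  | SBot => False
  | SEqu s t => eval e s = eval e t
  | SLess s t => lessS (eval e s) (eval e t)
  | SIn t X => E X (eval e t)
  | SImp p q => ssat e E p -> ssat e E q
  | SAllNum p => forall x : nat, ssat (scons (x : natS) e) E p
  | SAllSet p => forall A : nat -> Prop, ssat e (scons A E) p
  end.

(** * Coding of sets of natural numbers by elements of a model *)

(* Goedel's beta function: v is the remainder of c modulo 1 + (i + 1) * d. *)
Definition beta_form n (c d i v : term n) : form n :=
  let m := Add One (Mul (Add i One) d) in
  And (Less v m) (Ex (Equ (shift_term c)
                          (Add (Mul x0 (shift_term m)) (shift_term v)))).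

Definition shift2 n (t : term n) : term n.+2 := shift_term (shift_term t).
Definition shift3 n (t : term n) : term n.+3 := shift_term (shift2 t).

(* p = 2 ^ x: some beta-coded sequence starts with 1, doubles at each of the
   steps i < x, and has value p at x.  The prenex variables are c (x1) and
   d (x0). *)
Definition pow2_form n (x p : term n) : form n :=
  Ex (Ex (And (beta_form x1 x0 Zero One)
         (And (beta_form x1 x0 (shift2 x) (shift2 p))
              (* here i is x1, v is x0, and c, d have become x3, x2 *)
              (All (All (Imp (Less x1 (shift2 (shift2 x)))
                        (Imp (beta_form (shift2 x1) (shift2 x0) x1 x0)
                             (beta_form (shift2 x1) (shift2 x0)
                                        (Add x1 One) (Add x0 x0))))))))).

(* The binary digit of rank x of y is 1: there are p = 2 ^ x (x2), q (x1) and
   r < p (x0) with y = (2 * q + 1) * p + r. *)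
Definition mem_form n (x y : term n) : form n :=
  Ex (Ex (Ex (And (pow2_form (shift3 x) x2)
             (And (Less x0 x2)
                  (Equ (shift3 y)
                       (Add (Mul (Add (Add x1 x1) One) x2) x0)))))).

Definition num (M : structure) (k : nat) : M := iter k (fun x => addS x oneS) zeroS.

Definition coded_set (M : structure) (abar : M) : nat -> Prop :=
  fun k => sat (scons (num M k) (scons abar snil)) (mem_form x0 x1).

Definition codes (M : structure) (abar : M) (a : nat -> Prop) : Prop :=
  forall k, a k <-> coded_set abar k.

Definition SSy (M : structure) (a : nat -> Prop) : Prop :=
  exists abar : M, codes abar a.

(* Main.v *)
(* The crux is a modal definition of the standard cut.  Given t, let theta(v, t)
   say that no p <= v has "its facts" realized by a sequence of numbers through
   v and t, where the facts of p are finitely many equations a * b + c = d,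
   read off from t.  Let t code the real which assigns to each standard p an
   instance that, when realized in a model of T, already implies theta(v, t).
   For standard x, theta(x, t) holds: if p <= x were a counterexample, then the
   facts of p would be realized and hence imply theta(x, t).  For nonstandard x,
   theta(x, t) can be made false by an extension: otherwise, by compactness,
   finitely many equations true in the model imply theta(x, t); they are the
   facts of some standard p <= x and are realized, contradicting theta(x, t)
   itself.  So x is standard iff theta(x, t) is necessary, for this t.  For any
   other t, if the set of all y for which theta(y, t) is necessary is closed
   under successor and contains 0, then it contains the standard numbers, so
   standardness is expressed by quantifying over all such t in all extensions.

   Once the standard cut is available, number quantifiers are relativized to it
   and "for all reals" becomes "in every extension, for all elements": every
   real is coded in an ultrapower, and codes are preserved by embeddings because
   the binary digits of standard rank are determined by existential formulas. *)
Require Import Defs.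
From mathcomp Require Import all_boot.
From mathcomp Require Import boolp classical_sets filter.
From mathcomp Require Import zify.
From Stdlib Require Import Ring.
Set Implicit Arguments.
Unset Strict Implicit.
Unset Printing Implicit Defensive.

(** * Substitution and soundness *)

Lemma scons0 {X : Type} {n} (x : X) (v : 'I_n -> X) : scons x v ord0 = x.
Proof. by rewrite /scons unlift_none. Qed.

Lemma sconsS {X : Type} {n} (x : X) (v : 'I_n -> X) i :
  scons x v (lift ord0 i) = v i.
Proof. by rewrite /scons liftK. Qed.

Definition sconsE := (@scons0, @sconsS).

Lemma scons_unique {X : Type} {n} (x : X) (v : 'I_n -> X) (w : 'I_n.+1 -> X) :
  w ord0 = x -> (forall i, w (lift ord0 i) = v i) -> w = scons x v.
Proof.
move=> w0 wS; apply: funext => i.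
by case: (unliftP ord0 i) => [j ->|->]; rewrite sconsE.
Qed.

Lemma snil_unique {X : Type} (w : 'I_0 -> X) : w = snil.
Proof. by apply: funext => -[]. Qed.

Lemma comp_scons {X Y : Type} {n} (f : X -> Y) (x : X) (v : 'I_n -> X) :
  (fun i => f (scons x v i)) = scons (f x) (fun i => f (v i)).
Proof. by apply: scons_unique => [|i]; rewrite sconsE. Qed.

Lemma eval_subst (M : structure) n m (s : 'I_n -> term m) (e : 'I_m -> M) t :
  eval e (subst_term s t) = eval (fun i => eval e (s i)) t.
Proof. by elim: t => //= [t1 -> t2 ->|t1 -> t2 ->]. Qed.

Lemma eval_shift (M : structure) n (x : M) (e : 'I_n -> M) t :
  eval (scons x e) (shift_term t) = eval e t.
Proof.
by rewrite eval_subst; congr eval; apply: funext => i /=; rewrite sconsE.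
Qed.

Lemma sat_subst (M : structure) n (p : form n) m (s : 'I_n -> term m)
    (e : 'I_m -> M) :
  sat e (subst s p) <-> sat (fun i => eval e (s i)) p.
Proof.
elim: p m s e => {n} [n|n t1 t2|n t1 t2|n p IHp q IHq|n p IHp] m s e //=.
- by rewrite !eval_subst.
- by rewrite !eval_subst.
- by rewrite IHp IHq.
- have envE x : (fun i => eval (scons x e) (up s i)) =
                scons x (fun i => eval e (s i)).
    apply: scons_unique => [|i]; rewrite /up sconsE /= ?sconsE //.
    by rewrite eval_shift.
  by split=> H x; move: (H x); rewrite IHp envE.
Qed.

Lemma sat_inst (M : structure) n (p : form n.+1) t (e : 'I_n -> M) :
  sat e (inst t p) <-> sat (scons (eval e t) e) p.
Proof. by rewrite sat_subst comp_scons. Qed.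

Lemma sat_shift (M : structure) n (p : form n) (x : M) (e : 'I_n -> M) :
  sat (scons x e) (shift p) <-> sat e p.
Proof.
rewrite sat_subst.
by suff -> : (fun i => eval (scons x e) (Var (lift ord0 i))) = e by [];
  apply: funext => i /=; rewrite sconsE.
Qed.

Lemma sat_Imp (M : structure) n (e : 'I_n -> M) p q :
  sat e (Imp p q) <-> (sat e p -> sat e q).
Proof. by []. Qed.

Lemma sat_All (M : structure) n (e : 'I_n -> M) p :
  sat e (All p) <-> forall x, sat (scons x e) p.
Proof. by []. Qed.

Lemma sat_And (M : structure) n (e : 'I_n -> M) p q :
  sat e (And p q) <-> sat e p /\ sat e q.
Proof.
split=> /= [H|[Hp Hq] /(_ Hp)/(_ Hq)//].
by split; apply: contrapT => nH; apply: H => // Hp Hq; apply: nH.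
Qed.

Lemma sat_Ex (M : structure) n (e : 'I_n -> M) p :
  sat e (Ex p) <-> exists x, sat (scons x e) p.
Proof.
split=> /= [H|[x Hx] /(_ x Hx)//].
by apply: contrapT => nH; apply: H => x Hx; apply: nH; exists x.
Qed.

(** The relation [extends] speaks of provability; soundness is what turns models of [T] into models
    of [PA]. *)
Lemma prv_sound n (G : form n -> Prop) p : prv G p ->
  forall (M : structure) (e : 'I_n -> M),
    (forall q, G q -> sat e q) -> sat e p.
Proof.
elim=> {n G p} [n G p Gp|n G p q _ IH|n G p q _ IH1 _ IH2|n G p _ IH
  |n G p _ IH|n G p t _ IH|n G t|n G p s t _ IH1 _ IH2] M e eG //=.
- exact: eG.
- by move=> Hp; apply: IH => r [/eG//|->].
- exact: IH1 (IH2 _ _ eG).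
- by apply: contrapT => np; apply: (IH M e) => r [/eG//|->].
- by move=> x; apply: IH => r [q Gq ->]; apply/sat_shift/eG.
- by apply/sat_inst; apply: IH.
- by apply/sat_inst; rewrite -(IH1 _ _ eG); apply/sat_inst/IH2.
Qed.

Lemma models_extends (T S : theory) (M : structure) :
  extends T S -> models T M -> models S M.
Proof. by move=> TS MT p /TS/prv_sound; apply. Qed.

Lemma sat_univ_closure (M : structure) n (p : form n) :
  sat (M := M) snil (univ_closure p) -> forall e : 'I_n -> M, sat e p.
Proof.
elim: n p => [|n IHn] p /=; first by move=> ? e; rewrite (snil_unique e).
move=> /IHn H e.
rewrite (@scons_unique _ _ (e ord0) (fun i => e (lift ord0 i)) e) //.
exact: H.
Qed.

(** * Ultraproducts *)

Section Ultraproduct.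
Variables (I : Type) (U : set_system I) (UU : UltraFilter U).
Variable S : I -> structure.

Local Notation prodS := (forall i, S i).

Definition ultra_eq (g h : prodS) : Prop := U (fun i => g i = h i).

Lemma ultra_eq_refl g : ultra_eq g g.
Proof. by apply: filterS filterT. Qed.

Lemma ultra_eq_class g h : ultra_eq g h -> ultra_eq g = ultra_eq h.
Proof.
move=> gh; apply: funext => k; rewrite propeqE /ultra_eq; split.
  by apply: filterS2 gh => i <-.
by apply: filterS2 gh => i ->.
Qed.

Definition ultra_repr (g : prodS) : prodS :=
  projT1 (cid (ex_intro (ultra_eq g) g (ultra_eq_refl g))).

Lemma ultra_reprP g : ultra_eq g (ultra_repr g).
Proof. by rewrite /ultra_repr; case: cid. Qed.

(** The choice is made from the predicate [ultra_eq g], which is the same for equivalent functions;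
    proof irrelevance identifies the proofs of nonemptiness. *)
Lemma ultra_repr_eq g h : ultra_eq g h -> ultra_repr g = ultra_repr h.
Proof.
move=> /ultra_eq_class gh.
have cid_ext (P Q : prodS -> Prop) (hP : exists k, P k) (hQ : exists k, Q k) :
    P = Q -> projT1 (cid hP) = projT1 (cid hQ).
  by move=> PQ; subst Q; rewrite (Prop_irrelevance hP hQ).
exact: cid_ext.
Qed.

(** Classes are given by their chosen representatives, because [sat] reads [Equ] as Leibniz
    equality. *)
Record ultra_carrier := UltraCarrier {
  ultra_val : prodS;
  ultra_valP : ultra_repr ultra_val = ultra_val }.

Lemma ultra_reprK g : ultra_repr (ultra_repr g) = ultra_repr g.
Proof. exact/esym/ultra_repr_eq/ultra_reprP. Qed.

Definition ultra_class (g : prodS) : ultra_carrier :=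
  UltraCarrier (ultra_reprK g).

Lemma ultra_valK : cancel ultra_val ultra_class.
Proof.
move=> [g gP]; rewrite /ultra_class /=.
move: (ultra_reprK g); rewrite gP => gP'.
by rewrite (Prop_irrelevance gP gP').
Qed.

Lemma ultra_class_eq g h : ultra_class g = ultra_class h <-> ultra_eq g h.
Proof.
split=> [[gh]|/ultra_repr_eq gh].
  rewrite (ultra_eq_class (ultra_reprP g)) gh.
  rewrite -(ultra_eq_class (ultra_reprP h)); exact: ultra_eq_refl.
rewrite -(ultra_valK (ultra_class g)) -(ultra_valK (ultra_class h)) /=.
by rewrite gh.
Qed.

Definition ultraproduct : structure :=
  @Structure ultra_carrier
    (ultra_class (fun i => zeroS)) (ultra_class (fun i => oneS))
    (fun x y => ultra_class (fun i => addS (ultra_val x i) (ultra_val y i)))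
    (fun x y => ultra_class (fun i => mulS (ultra_val x i) (ultra_val y i)))
    (fun x y => U (fun i => lessS (ultra_val x i) (ultra_val y i))).

Lemma ultra_classK g : U (fun i => ultra_val (ultra_class g) i = g i).
Proof. by apply: filterS (ultra_reprP g) => i /= ->. Qed.

Lemma ultra_classD g h :
  addS (s := ultraproduct) (ultra_class g) (ultra_class h) =
  ultra_class (fun i => addS (g i) (h i)).
Proof.
apply/ultra_class_eq.
by apply: filterS2 (ultra_classK g) (ultra_classK h) => i /= -> ->.
Qed.

Lemma ultra_classM g h :
  mulS (s := ultraproduct) (ultra_class g) (ultra_class h) =
  ultra_class (fun i => mulS (g i) (h i)).
Proof.
apply/ultra_class_eq.
by apply: filterS2 (ultra_classK g) (ultra_classK h) => i /= -> ->.
Qed.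

Lemma eval_ultraproduct n (e : 'I_n -> prodS) t :
  eval (M := ultraproduct) (fun j => ultra_class (e j)) t =
  ultra_class (fun i => eval (fun j => e j i) t).
Proof.
by elim: t => [||| t1 IH1 t2 IH2 | t1 IH1 t2 IH2] //;
  rewrite -?ultra_classD -?ultra_classM -IH1 -IH2.
Qed.

(** Maximality of [U] enters from right to left: either [P] or its complement is in [U]. *)
Lemma ultra_Imp (P Q : set I) : U (fun i => P i -> Q i) <-> (U P -> U Q).
Proof.
split=> [PQ UP|PQ]; first by apply: filterS2 PQ UP => i; apply.
have [/PQ UQ|UP] := in_ultra_setVsetC P UU.
  by apply: filterS UQ => i Qi _.
by apply: filterS UP => i nPi /nPi.
Qed.

(** This is Łoś's theorem, by induction on the formula. *)
Lemma sat_ultraproduct n (p : form n) (e : 'I_n -> prodS) :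
  sat (M := ultraproduct) (fun j => ultra_class (e j)) p <->
  U (fun i => sat (fun j => e j i) p).
Proof.
elim: p e => {n} [n|n t1 t2|n t1 t2|n p IHp q IHq|n p IHp] e /=.
- by split=> // U0; apply: (@filter_not_empty _ U).
- by rewrite !eval_ultraproduct ultra_class_eq.
- rewrite !eval_ultraproduct /=.
  have K1 := ultra_classK (fun i => eval (fun j => e j i) t1).
  have K2 := ultra_classK (fun i => eval (fun j => e j i) t2).
  by split=> H; apply: filterS3 K1 K2 H => i /= -> ->.
- by rewrite IHp IHq ultra_Imp.
have envE x : scons (ultra_class x) (fun j => ultra_class (e j)) =
    fun j => ultra_class (scons x e j) by rewrite comp_scons.
have envE' i x : (fun j => scons x e j i) = scons (x i) (fun j => e j i).
  by apply: scons_unique => [|j]; rewrite sconsE.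
split=> [H|H x]; last first.
  rewrite -(ultra_valK x) envE; apply/IHp.
  by apply: filterS H => i Hi; rewrite envE'.
(* [w] takes a counterexample at each index that has one, and the dummy value zero elsewhere; hence
   wherever [p] holds at [w i], it holds at every element of that factor. *)
pose bad i x := ~ sat (scons x (fun j => e j i)) p.
pose w i := if pselect (exists x, bad i x) is left h then projT1 (cid h)
            else zeroS.
move: (H (ultra_class w)); rewrite envE => /IHp.
apply: filterS => i; rewrite envE' /w.
case: pselect => [h|h _ x]; first by case: (cid h).
by apply: contrapT => nx; apply: h; exists x.
Qed.

Lemma models_ultraproduct (T : theory) :
  (forall i, models T (S i)) -> models T ultraproduct.
Proof.
move=> ST p Tp.
rewrite -(snil_unique (fun j : 'I_0 => ultra_class (snil j))).
apply/sat_ultraproduct; apply: filterS filterT => i _.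
by rewrite (snil_unique (fun j : 'I_0 => _)); apply: ST.
Qed.

End Ultraproduct.
(** * Arithmetic in a model of PA *)

Declare Scope arith_scope.
Delimit Scope arith_scope with A.
Infix "+" := addS : arith_scope.
Infix "*" := mulS : arith_scope.
Infix "<" := lessS : arith_scope.
Notation "0" := zeroS : arith_scope.
Notation "1" := oneS : arith_scope.

Notation x0 := (Var ord0).
Notation x1 := (Var (lift ord0 ord0)).
Notation x2 := (Var (lift ord0 (lift ord0 ord0))).
Notation x3 := (Var (lift ord0 (lift ord0 (lift ord0 ord0)))).

Section Arithmetic.
Variables (M : structure) (MPA : models PA M).
Local Open Scope arith_scope.
Implicit Types a b c d h m q r u v w x y z : M.

(** Induction in [M] reaches only definable predicates: [p] with parameters [e] is the definition,
    and [P] the readable meaning used in the induction steps. *)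
Lemma PA_ind n (p : form n.+1) (e : 'I_n -> M) (P : M -> Prop) :
  (forall x, sat (scons x e) p <-> P x) ->
  P 0 -> (forall x, P x -> P (x + 1)) -> forall x, P x.
Proof.
move=> pP P0 PS x; apply/pP.
have /sat_univ_closure/(_ e) := MPA (PA_induction p); apply.
  by apply/sat_inst/pP.
move=> y /pP/PS/pP Hy; apply/sat_subst.
rewrite comp_scons /= sconsE.
by rewrite (_ : (fun i => _) = e) //; apply: funext => i; rewrite sconsE.
Qed.

Lemma succ_neq0 x : x + 1 <> 0.
Proof. by have /= := MPA PA_succ_neq0 => /(_ x); rewrite !sconsE. Qed.

Lemma succ_inj x y : x + 1 = y + 1 -> x = y.
Proof. by have /= := MPA PA_succ_inj => /(_ x y); rewrite !sconsE. Qed.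

Lemma add0x x : 0 + x = x.
Proof. by have /= := MPA PA_zero_add => /(_ x); rewrite !sconsE. Qed.

Lemma addx0 x : x + 0 = x.
Proof. by have /= := MPA PA_add_zero => /(_ x); rewrite !sconsE. Qed.

Lemma addxS x y : x + (y + 1) = (x + y) + 1.
Proof. by have /= := MPA PA_add_succ => /(_ x y); rewrite !sconsE. Qed.

Lemma mulx0 x : x * 0 = 0.
Proof. by have /= := MPA PA_mul_zero => /(_ x); rewrite !sconsE. Qed.

Lemma mulxS x y : x * (y + 1) = x * y + x.
Proof. by have /= := MPA PA_mul_succ => /(_ x y); rewrite !sconsE. Qed.

Lemma lessE x y : x < y <-> exists z, x + (z + 1) = y.
Proof.
have /sat_And[/sat_Imp H1 /sat_Imp H2] : sat (scons y (scons x snil))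
  (Iff (Less x1 x0) (Ex (Equ (Add x2 (Add x0 One)) x1))) := MPA PA_less x y.
split=> [xy|[z xzy]].
  have /H1/sat_Ex[z] : sat (scons y (scons x snil)) (Less x1 x0).
    by rewrite /= !sconsE.
  by rewrite /= !sconsE; exists z.
rewrite /= !sconsE in H2; apply: H2 => /(_ z); apply.
by rewrite !sconsE.
Qed.

Lemma case_succ x : x = 0 \/ exists y, x = y + 1.
Proof.
elim/(@PA_ind 0 (Imp (Neg (Equ x0 Zero)) (Ex (Equ x1 (Add x0 One)))) snil) : x
  => [x||x _]; [|by left|by right; exists x].
rewrite /= !sconsE; split=> [H|[->//|[y xy] _ /(_ y)]]; last first.
  by rewrite !sconsE; apply.
have [->|/H nH] := pselect (x = 0); first by left.
right; apply: contrapT => nx; apply: nH => y; rewrite !sconsE => xy.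
by apply: nx; exists y.
Qed.

Lemma add1x x : 1 + x = x + 1.
Proof.
elim/(@PA_ind 0 (Equ (Add One x0) (Add x0 One)) snil) : x => [x||x IH].
- by rewrite /= !sconsE.
- by rewrite addx0 add0x.
- by rewrite addxS IH.
Qed.

Lemma addA x y z : x + (y + z) = x + y + z.
Proof.
elim/(@PA_ind 2 (Equ (Add x1 (Add x2 x0)) (Add (Add x1 x2) x0))
         (scons x (scons y snil))) : z => [z||z IH].
- by rewrite /= !sconsE.
- by rewrite !addx0.
- by rewrite !addxS IH.
Qed.

Lemma addC x y : x + y = y + x.
Proof.
elim/(@PA_ind 1 (Equ (Add x1 x0) (Add x0 x1)) (scons x snil)) : y => [y||y IH].
- by rewrite /= !sconsE.
- by rewrite addx0 add0x.
- by rewrite addxS IH -addxS -(add1x x) addA.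
Qed.

Lemma mul0x x : 0 * x = 0.
Proof.
elim/(@PA_ind 0 (Equ (Mul Zero x0) Zero) snil) : x => [x||x IH].
- by rewrite /= !sconsE.
- by rewrite mulx0.
- by rewrite mulxS IH addx0.
Qed.

Lemma mulDl x y z : (x + y) * z = x * z + y * z.
Proof.
elim/(@PA_ind 2 (Equ (Mul (Add x1 x2) x0) (Add (Mul x1 x0) (Mul x2 x0)))
         (scons x (scons y snil))) : z => [z||z IH].
- by rewrite /= !sconsE.
- by rewrite !mulx0 addx0.
- rewrite !mulxS IH -!addA; congr (_ + _).
  by rewrite addA [y * z + x]addC -addA.
Qed.

Lemma mul1x x : 1 * x = x.
Proof.
elim/(@PA_ind 0 (Equ (Mul One x0) x0) snil) : x => [x||x IH].
- by rewrite /= !sconsE.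
- by rewrite mulx0.
- by rewrite mulxS IH.
Qed.

Lemma mulC x y : x * y = y * x.
Proof.
elim/(@PA_ind 1 (Equ (Mul x1 x0) (Mul x0 x1)) (scons x snil)) : y => [y||y IH].
- by rewrite /= !sconsE.
- by rewrite mulx0 mul0x.
- by rewrite mulxS mulDl mul1x IH.
Qed.

Lemma mulA x y z : x * (y * z) = x * y * z.
Proof.
elim/(@PA_ind 2 (Equ (Mul x1 (Mul x2 x0)) (Mul (Mul x1 x2) x0))
         (scons x (scons y snil))) : z => [z||z IH].
- by rewrite /= !sconsE.
- by rewrite !mulx0.
- by rewrite !mulxS -IH ![x * _]mulC mulDl.
Qed.

Lemma semiring : @semi_ring_theory M 0 1 (@addS M) (@mulS M) eq.
Proof.
by split; [exact: add0x | exact: addC | exact: addA | exact: mul1x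
  | exact: mul0x | exact: mulC | exact: mulA | exact: mulDl].
Qed.

Add Ring model_ring : semiring.

Lemma addxI x y z : x + z = y + z -> x = y.
Proof.
elim/(@PA_ind 2 (Imp (Equ (Add x1 x0) (Add x2 x0)) (Equ x1 x2))
         (scons x (scons y snil))) : z => [z||z IH].
- by rewrite /= !sconsE.
- by rewrite !addx0.
- by rewrite !addxS => /succ_inj.
Qed.

Lemma addIx x y z : z + x = z + y -> x = y.
Proof. by rewrite ![z + _]addC; exact: addxI. Qed.

Lemma add_succ_neq x y : x + (y + 1) <> x.
Proof.
move=> H; apply: (@succ_neq0 y); apply: (@addIx _ _ x).
by rewrite addx0.
Qed.

Lemma less_irrefl x : ~ x < x.
Proof. by move/lessE => [z /add_succ_neq]. Qed.

Lemma less_trans x y z : x < y -> y < z -> x < z.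
Proof.
move=> /lessE[u <-] /lessE[v <-]; apply/lessE; exists (u + 1 + v).
ring.
Qed.

Lemma less_total x y : x < y \/ x = y \/ y < x.
Proof.
(* Disjunction is not primitive, so trichotomy is written as two negated premises implying the third
   case. *)
elim/(@PA_ind 1 (Imp (Neg (Less x0 x1)) (Imp (Neg (Equ x0 x1)) (Less x1 x0)))
         (scons y snil)) : x => [x||x IH].
- rewrite /= !sconsE; split=> [H|[//|[//|//]] _ //].
  have [|nlt] := pselect (x < y); first by left.
  have [|neq] := pselect (x = y); first by right; left.
  by right; right; apply: H.
- have [->|[z ->]] := case_succ y; first by right; left.
  by left; apply/lessE; exists z; rewrite add0x.
- case: IH => [/lessE[z <-]|[->|/lessE[z <-]]].
  + have [->|[u ->]] := case_succ z; first by right; left; ring.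
    by left; apply/lessE; exists u; ring.
  + by right; right; apply/lessE; exists 0; ring.
  + by right; right; apply/lessE; exists (z + 1); ring.
Qed.

Lemma less_addr x y : x < x + (y + 1).
Proof. by apply/lessE; exists y. Qed.

Lemma not_add_less x y : ~ x + y < x.
Proof.
move/lessE=> [z H]; apply: (@add_succ_neq x (y + z)).
by rewrite -[RHS]H; ring.
Qed.

Lemma not_less_add x y : ~ x < y -> exists z, x = y + z.
Proof.
have [//|[->|/lessE[z <-]]] := less_total x y => _.
  by exists 0; rewrite addx0.
by exists (z + 1).
Qed.

Lemma less_succ x y : x < y + 1 <-> x < y \/ x = y.
Proof.
split=> [/lessE[z]|[/lessE[z <-]|->]].
- rewrite addA => /succ_inj <-.
  have [->|[u ->]] := case_succ z; first by right; ring.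
  by left; apply: less_addr.
- by apply/lessE; exists (z + 1); ring.
- by apply/lessE; exists 0; ring.
Qed.

Lemma not_less0 x : ~ x < 0.
Proof. by move/lessE=> [z]; rewrite addA => /succ_neq0. Qed.

(** ** Division *)

Lemma division m c : m <> 0 -> exists q r, c = q * m + r /\ r < m.
Proof.
have [->//|[k ->] _] := case_succ m.
elim/(@PA_ind 1 (Ex (Ex (And (Equ x2 (Add (Mul x1 (Add x3 One)) x0))
                          (Less x0 (Add x3 One))))) (scons k snil)) : c
  => [c||c [q [r [-> /lessE[z rz]]]]].
- rewrite sat_Ex; split=> [[q /sat_Ex[r /sat_And]]|[q [r H]]].
    by rewrite /= !sconsE => H; exists q, r.
  by exists q; apply/sat_Ex; exists r; apply/sat_And; rewrite /= !sconsE.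
- by exists 0, 0; split; [ring | apply/lessE; exists k; ring].
(* [z] is the gap between [r + 1] and the modulus: when it is zero the remainder wraps around and
   the quotient grows, otherwise the remainder grows. *)
- have [z0|[u zu]] := case_succ z.
    exists (q + 1), 0; split; first by rewrite -rz z0; ring.
    by apply/lessE; exists k; ring.
  exists q, (r + 1); split; first by ring.
  by apply/lessE; exists u; rewrite -rz zu; ring.
Qed.

Lemma quotient_le m q q' r r' :
  q * m + r = q' * m + r' -> r < m -> ~ q < q'.
Proof.
move=> H /lessE[u um] /lessE[z zq]; subst m q'.
(* With [q' = q + z + 1] and [m = r + u + 1], the right side exceeds the left by
   [z * m + u + r' + 1], which cannot be zero. *)
apply: (@succ_neq0 (z * (r + (u + 1)) + u + r')).
apply: (@addIx _ _ (q * (r + (u + 1)) + r)); rewrite addx0 [RHS]H.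
ring.
Qed.

Lemma division_unique m q q' r r' :
  q * m + r = q' * m + r' -> r < m -> r' < m -> q = q' /\ r = r'.
Proof.
move=> H rm r'm.
have [qq'|[qq'|qq']] := less_total q q'.
- by case: (quotient_le H rm qq').
- by subst q'; split=> //; apply: addIx H.
- by case: (quotient_le (esym H) r'm qq').
Qed.

(** ** Standard elements *)

Lemma numS k : num M k.+1 = num M k + 1. Proof. by []. Qed.

Lemma numD k l : num M (k + l) = num M k + num M l.
Proof.
by elim: k => [|k IHk]; rewrite ?add0x // addSn !numS IHk; ring.
Qed.

Lemma numM k l : num M (k * l) = num M k * num M l.
Proof.
elim: k => [|k IHk]; first by rewrite mul0x.
by rewrite mulSn numD IHk numS; ring.
Qed.

Lemma num1 : num M 1 = 1. Proof. exact: add0x. Qed.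

Lemma num_inj k l : num M k = num M l -> k = l.
Proof.
elim: k l => [|k IHk] [|l] //=; rewrite ?numS.
- by move/esym/succ_neq0.
- by move/succ_neq0.
- by move/succ_inj/IHk ->.
Qed.

Lemma num_less k l : (num M k < num M l) <-> (k < l)%N.
Proof.
elim: l k => [|l IHl] k; first by rewrite ltn0; split=> // /not_less0.
rewrite less_succ IHl ltnS [(k <= l)%N]leq_eqVlt.
split=> [[->|/num_inj->]|/orP[/eqP->|]]; rewrite ?eqxx ?orbT //; by [right|left].
Qed.

Lemma less_num x k : x < num M k -> exists2 l, (l < k)%N & x = num M l.
Proof.
elim: k => [/not_less0//|k IHk /less_succ[/IHk[l lk ->]|->]].
  by exists l => //; apply: ltnW.
by exists k.
Qed.

Lemma num_less_nonstandard x k : (forall l, x <> num M l) -> num M k < x.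
Proof.
move=> nx; have [//|[kx|/less_num[l _ xl]]] := less_total (num M k) x.
  by case: (nx k).
by case: (nx l).
Qed.

(** * The beta function *)

(** Multiples of [m] are added on both sides since there is no subtraction. *)
Definition congrM m a b : Prop := exists u v, a + m * u = b + m * v.

Lemma congr_refl m a : congrM m a a.
Proof. by exists 0, 0. Qed.

Lemma congr_trans m a b c : congrM m a b -> congrM m b c -> congrM m a c.
Proof.
move=> [u [v H]] [u' [v' H']]; exists (u + u'), (v + v').
transitivity (a + m * u + m * u'); first by ring.
rewrite H; transitivity (b + m * u' + m * v); first by ring.
by rewrite H'; ring.
Qed.

Lemma congr_add m a a' b b' :
  congrM m a a' -> congrM m b b' -> congrM m (a + b) (a' + b').
Proof.
move=> [u [v H]] [u' [v' H']]; exists (u + u'), (v + v').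
transitivity ((a + m * u) + (b + m * u')); first by ring.
by rewrite H H'; ring.
Qed.

Lemma congr_mul m a a' b b' :
  congrM m a a' -> congrM m b b' -> congrM m (a * b) (a' * b').
Proof.
move=> [u [v H]] [u' [v' H']].
exists (a * u' + b * u + m * (u * u')), (a' * v' + b' * v + m * (v * v')).
transitivity ((a + m * u) * (b + m * u')); first by ring.
by rewrite H H'; ring.
Qed.

Lemma congr_addM m a b : congrM m (a + m * b) a.
Proof. by exists 0, b; ring. Qed.

Lemma congr_remainder m a b :
  congrM m a b -> b < m -> exists q, a = q * m + b.
Proof.
move=> [u [v H]] bm.
have [/lessE[z zu]|/not_less_add[z zv]] := pselect (v < u).
  subst u; have E : a + m * (z + 1) = b.
    by apply: (@addxI _ _ (m * v)); rewrite -H; ring.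
  by case: (@not_add_less m (a + m * z)); rewrite -E in bm; move: bm;
    rewrite (_ : a + m * (z + 1) = m + (a + m * z)); last ring.
subst v; exists z; apply: (@addxI _ _ (m * u)); rewrite H; ring.
Qed.

Definition betaM c d i v : Prop :=
  v < 1 + (i + 1) * d /\ exists q, c = q * (1 + (i + 1) * d) + v.

Lemma sat_beta n (e : 'I_n -> M) tc td ti tv :
  sat e (beta_form tc td ti tv) <->
  betaM (eval e tc) (eval e td) (eval e ti) (eval e tv).
Proof.
rewrite /beta_form /betaM; set tm := Add One _;
rewrite -[1 + _ * _]/(eval e tm); move: tm => tm.
rewrite sat_And sat_Ex; split=> -[vm [q qE]]; split=> //; exists q; move: qE.
  by rewrite /= !eval_shift !sconsE.
by rewrite /= !eval_shift !sconsE.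
Qed.

Lemma beta_total c d i : exists v, betaM c d i v.
Proof.
have [|q [v [-> vm]]] := @division (1 + (i + 1) * d) c.
  by rewrite addC; exact: succ_neq0.
by exists v; split=> //; exists q.
Qed.

Lemma beta_unique c d i v v' : betaM c d i v -> betaM c d i v' -> v = v'.
Proof.
move=> [vm [q ->]] [v'm [q' H]].
by case: (division_unique H vm v'm).
Qed.

(** Take the factorial of [K] times a common bound [s] of the [w i]; the factorial is at least 1, so
    the product still bounds them. *)
Lemma bounded_common_multiple K (w : nat -> M) : exists d,
  (forall i, (i <= K)%N -> exists h, d = w i + h) /\
  (forall e, (0 < e <= K)%N -> exists h, d = num M e * h).
Proof.
have [s sP] : exists s, forall i, (i <= K)%N -> exists h, s = w i + h.
  elim: K => [|K [s IHs]]; first by exists (w 0%N) => -[] // _; exists 0; ring.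
  exists (w K.+1 + s) => i; rewrite leq_eqVlt ltnS => /orP[/eqP->|/IHs[h ->]].
    by exists s.
  by exists (w K.+1 + h); ring.
exists (num M K`! * s); split=> [i /sP[h ->]|e eK].
  rewrite -(prednK (fact_gt0 K)) numS.
  by exists (num M K`!.-1 * (w i + h) + h); ring.
have /dvdnP[f ->] : e %| K`! by apply: dvdn_fact.
by rewrite numM; exists (num M f * s); ring.
Qed.

Lemma beta_moduli_coprime d i e h : d = e * h ->
  exists u, congrM (1 + (i + e + 1) * d) ((1 + (i + 1) * d) * u) 1.
Proof.
move=> ->; set j := i + e + 1; exists (j * h * j * j * (e * h)).
exists 1, (j * (e * h) + (i + 1) * h * j * j * (e * h)); rewrite /j; ring.
Qed.

(** The Chinese remainder theorem for a sequence of standard length. The induction takes place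
    outside [M], so [w] need not be definable in [M]. *)
Lemma beta_seq K (w : nat -> M) :
  exists c d, forall i, (i <= K)%N -> betaM c d (num M i) (w i).
Proof.
have [d [dw dK]] := bounded_common_multiple K w.
pose m i := 1 + (num M i + 1) * d.
have inv i j : (i < j <= K)%N -> exists u, congrM (m j) (m i * u) 1.
  move=> /andP[ij jK];
  have [|h /(beta_moduli_coprime (num M i))] := dK (j - i)%N.
    by rewrite subn_gt0 ij (leq_trans (leq_subr _ _)).
  by rewrite -numD subnKC // ltnW.
(* [P] is the product of the moduli before [j]; it is invertible modulo each of the remaining
   ones. *)
have prod j : (j <= K)%N -> exists P,
    (forall i, (i < j)%N -> exists h, P = m i * h)
    /\ (forall l, (j <= l <= K)%N -> exists u, congrM (m l) (P * u) 1).
  elim: j => [_|j IHj jK].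
    by exists 1; split=> // l _; exists 1; rewrite mul1x; exact: congr_refl.
  have [P [Pd Pu]] := IHj (ltnW jK); exists (P * m j); split=> [i|l jlK].
    rewrite ltnS leq_eqVlt => /orP[/eqP->|/Pd[h ->]]; first by exists P; ring.
    by exists (h * m j); ring.
  have [u uP] := inv j l jlK.
  have [v vP] : exists u, congrM (m l) (P * u) 1.
    by apply: Pu; case/andP: jlK => /ltnW-> ->.
  exists (v * u); rewrite (_ : P * m j * (v * u) = (P * v) * (m j * u));
    last by ring.
  by rewrite -(mul1x 1); apply: congr_mul.
have [c cP] : exists c, forall i, (i < K.+1)%N -> congrM (m i) c (w i).
  have: (K.+1 <= K.+1)%N by [].
  elim: {1 3}K.+1 => [|j IHj jK]; first by exists 0.
  have [c cP] := IHj (ltnW jK); have [P [Pd Pu]] := prod j jK.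
  have [|u uP] := Pu j; first by rewrite leqnn.
  (* The correction is [P * u * (w j - c)] with [-1] replaced by [(num M j + 1) * d], which is
     congruent to it modulo [m j]. Being a multiple of [P], it preserves the earlier congruences. *)
  exists (c + P * u * (w j + (num M j + 1) * d * c)) => i.
  rewrite ltnS leq_eqVlt => /orP[/eqP->|ij]; last first.
    have [h ->] := Pd i ij; apply: congr_trans (cP i ij).
    rewrite (_ : c + _ = c + m i * (h * u * (w j + (num M j + 1) * d * c))).
      exact: congr_addM.
    ring.
  apply: (@congr_trans _ _ (c + 1 * (w j + (num M j + 1) * d * c))).
    by apply: congr_add (congr_refl _ _) (congr_mul uP (congr_refl _ _)).
  rewrite (_ : c + _ = w j + m j * c); first exact: congr_addM.
  rewrite /m; ring.
exists c, d => i iK.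
have wm : w i < m i.
  have [h dE] := dw i iK; apply/lessE; exists (num M i * d + h).
  by rewrite /m mulDl mul1x {3}dE; ring.
by split=> //; apply: congr_remainder (cP i iK) wm.
Qed.

(** * Binary digits *)

Definition pow2M x p : Prop := exists c d,
  [/\ betaM c d 0 1, betaM c d x p &
      forall i v, i < x -> betaM c d i v -> betaM c d (i + 1) (v + v)].

Definition memM x y : Prop := exists p q r,
  [/\ pow2M x p, r < p & y = (q + q + 1) * p + r].

Lemma sat_pow2 n (e : 'I_n -> M) s t :
  sat e (pow2_form s t) <-> pow2M (eval e s) (eval e t).
Proof.
rewrite sat_Ex /pow2M.
have step c d : sat (scons d (scons c e))
      (All (All (Imp (Less x1 (shift2 (shift2 s)))
      (Imp (beta_form (shift2 x1) (shift2 x0) x1 x0)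
        (beta_form (shift2 x1) (shift2 x0) (Add x1 One) (Add x0 x0)))))) <->
    forall i v, i < eval e s -> betaM c d i v -> betaM c d (i + 1) (v + v).
  split=> [/sat_All H i v|H].
    have /sat_All/(_ v) := H i.
    by rewrite 2!sat_Imp !sat_beta /= /shift2 !eval_shift /= !sconsE.
  apply/sat_All => i; apply/sat_All => v.
  rewrite 2!sat_Imp !sat_beta /= /shift2 !eval_shift /= !sconsE; exact: H.
split=> [[c /sat_Ex[d]]|[c [d [H1 H2 H3]]]].
  rewrite 2!sat_And step !sat_beta /= !sconsE /shift2 !eval_shift => -[H1 [H2 H3]].
  by exists c, d.
exists c; apply/sat_Ex; exists d.
by rewrite 2!sat_And step !sat_beta /= !sconsE /shift2 !eval_shift.
Qed.

Lemma sat_mem n (e : 'I_n -> M) s t :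
  sat e (mem_form s t) <-> memM (eval e s) (eval e t).
Proof.
have matrixE p q r : sat (scons r (scons q (scons p e)))
    (And (pow2_form (shift3 s) x2) (And (Less x0 x2)
      (Equ (shift3 t) (Add (Mul (Add (Add x1 x1) One) x2) x0)))) <->
    [/\ pow2M (eval e s) p, r < p & eval e t = (q + q + 1) * p + r].
  rewrite 2!sat_And sat_pow2 /= /shift3 /shift2 !eval_shift !sconsE.
  by split=> [[? []]|[]].
rewrite sat_Ex; split=> [[p /sat_Ex[q /sat_Ex[r /matrixE H]]]|[p [q [r H]]]].
  by exists p, q, r.
exists p; apply/sat_Ex; exists q; apply/sat_Ex; exists r; exact/matrixE.
Qed.

(** At a standard exponent the recursion forces the values of any beta code step by step, and
    [beta_seq] supplies a code. *)
Lemma pow2_num k p : pow2M (num M k) p <-> p = num M (2 ^ k).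
Proof.
split=> [[c [d [c0 cp cS]]]|->].
  have pow i : (i <= k)%N -> betaM c d (num M i) (num M (2 ^ i)).
    elim: i => [_|i IHi ik]; first by rewrite num1.
    rewrite expnS mul2n -addnn numD numS; apply: cS; last exact/IHi/ltnW.
    exact/num_less.
  exact: beta_unique cp (pow k _).
have [c [d cd]] := beta_seq k (fun i => num M (2 ^ i)).
exists c, d; split=> [||i v /less_num[j jk ->] /beta_unique].
- by have := cd 0%N isT; rewrite expn0 num1.
- exact: cd.
- move=> /(_ _ (cd j (ltnW jk))) ->.
  by have := cd j.+1 jk; rewrite expnS mul2n -addnn numD numS.
Qed.

Lemma mem_num k y : memM (num M k) y <->
  exists q r, r < num M (2 ^ k) /\ y = (q + q + 1) * num M (2 ^ k) + r.
Proof.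
split=> [[p [q [r [/pow2_num-> rp ->]]]]|[q [r [rp ->]]]].
  by exists q, r.
by exists (num M (2 ^ k)), q, r; split=> //; apply/pow2_num.
Qed.

Lemma even_or_odd x : (exists q, x = q + q) \/ (exists q, x = q + q + 1).
Proof.
have [|q [r [-> /less_num[[|[|//]] _ ->]]]] := @division (num M 2) x.
- by rewrite numS; exact: succ_neq0.
- by left; exists q; rewrite /num /=; ring.
- by right; exists q; rewrite /num /=; ring.
Qed.

Lemma even_odd_neq q q' : q + q <> q' + q' + 1.
Proof.
move=> H; have : q * num M 2 + num M 0 = q' * num M 2 + num M 1.
  by transitivity (q + q); [|rewrite H]; rewrite /num /=; ring.
by move=> /division_unique[]; [exact/num_less|exact/num_less|move=> _ /num_inj].
Qed.

(** For standard [k], non-membership also becomes existential, with an even quotient in place of an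
    odd one. This makes it pass to extensions just as membership does. *)
Lemma not_mem_num k y : ~ memM (num M k) y <->
  exists q r, r < num M (2 ^ k) /\ y = (q + q) * num M (2 ^ k) + r.
Proof.
have pow_neq0 : num M (2 ^ k) <> 0.
  by move=> /(@num_inj _ 0%N) H; have := expn_gt0 2 k; rewrite H.
rewrite mem_num; split=> [H|[q [r [rp yE]]] [q' [r' [r'p yE']]]].
  have [x [r [yE rp]]] := division y pow_neq0.
  have [[q xE]|[q xE]] := even_or_odd x; subst x; first by exists q, r.
  by case: H; exists q, r.
have [/even_odd_neq] := division_unique (etrans (esym yE) yE') rp r'p.
by [].
Qed.

Lemma mem_num_num k n : memM (num M k) (num M n) <-> odd (n %/ 2 ^ k).
Proof.
have nE := divn_eq n (2 ^ k); have oddE := odd_double_half (n %/ 2 ^ k).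
have r_lt : num M (n %% 2 ^ k) < num M (2 ^ k).
  by apply/num_less; rewrite ltn_mod expn_gt0.
set q := num M (n %/ 2 ^ k)./2.
case: (odd _) oddE => oddE.
  split=> // _; apply/mem_num; exists q, (num M (n %% 2 ^ k)); split=> //.
  rewrite {1}nE -{1}oddE -addnn addnC numD numM !numD num1 -/q; ring.
split=> // /mem_num; suff /not_mem_num : ~ memM (num M k) (num M n).
  by move=> /not_mem_num nH /mem_num.
apply/not_mem_num; exists q, (num M (n %% 2 ^ k)); split=> //.
rewrite {1}nE -{1}oddE -addnn add0n numD numM !numD -/q; ring.
Qed.
End Arithmetic.

(** * Extensions of models *)

(** The order is existentially definable from addition, hence preserved; trichotomy in [M] and
    irreflexivity in [N] then yield injectivity and reflection of the order. *)
Lemma hom_embedding (M N : structure) (f : M -> N) :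
  models PA M -> models PA N -> f zeroS = zeroS -> f oneS = oneS ->
  {morph f : x y / (x + y)%A} -> {morph f : x y / (x * y)%A} -> embedding f.
Proof.
move=> MPA NPA f0 f1 fD fM.
have fless x y : lessS x y -> lessS (f x) (f y).
  move=> /(lessE MPA)[z <-]; apply/(lessE NPA).
  by exists (f z); rewrite !fD f1.
split=> //.
- move=> x y fxy; have [/fless|[//|/fless]] := less_total MPA x y;
  by rewrite fxy => /(less_irrefl NPA).
- move=> x y; split=> [/fless//|fxy].
  have [//|[xy|/fless/(less_trans NPA fxy)]] := less_total MPA x y.
    by move: fxy; rewrite xy => /(less_irrefl NPA).
  by move=> /(less_irrefl NPA).
Qed.

Section Embedding.
Variables (M N : structure) (MPA : models PA M) (NPA : models PA N).
Variables (f : M -> N) (fE : embedding f).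

Lemma embedding_num k : f (num M k) = num N k.
Proof.
by elim: k => [|k IHk]; rewrite ?(emb_zero fE) // !numS emb_add // IHk emb_one.
Qed.

Lemma embedding_eval n (e : 'I_n -> M) t :
  f (eval e t) = eval (fun i => f (e i)) t.
Proof.
elim: t => //= [||t1 <- t2 <-|t1 <- t2 <-]; by [case: fE].
Qed.

(** Both a digit 1 and a digit 0 at standard rank have existential witnesses, which [f] carries to
    [N]. *)
Lemma embedding_mem_num k y : memM (num N k) (f y) <-> memM (num M k) y.
Proof.
have up q r : (f (q * num M (2 ^ k) + r) = f q * num N (2 ^ k) + f r)%A.
  by rewrite (emb_add fE) (emb_mul fE) embedding_num.
split=> [|/(mem_num MPA)[q [r [rp ->]]]]; last first.
  apply/(mem_num NPA); exists (f q), (f r); split.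
    by rewrite -embedding_num; apply/(emb_less fE).
  by rewrite up !(emb_add fE) (emb_one fE).
move=> Nk; apply: contrapT => /(not_mem_num MPA)[q [r [rp yE]]].
suff /(not_mem_num NPA) : exists q' r',
    lessS r' (num N (2 ^ k)) /\ f y = ((q' + q') * num N (2 ^ k) + r')%A by apply.
exists (f q), (f r); split.
  by rewrite -embedding_num; apply/(emb_less fE).
by rewrite yE up !(emb_add fE).
Qed.
End Embedding.

Lemma coded_setE (M : structure) (y : M) k :
  coded_set y k <-> memM (num M k) y.
Proof. by rewrite /coded_set sat_mem /= !sconsE. Qed.

Lemma embedding_coded_set (M N : structure) (f : M -> N) y :
  models PA M -> models PA N -> embedding f ->
  coded_set (f y) = coded_set y.
Proof.
move=> MPA NPA fE; apply: funext => k; rewrite propeqE !coded_setE.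
exact: embedding_mem_num.
Qed.

(* Equations a * b + c = d do for the whole diagram of M: with a = 1 or c = 0
   they say that f is a homomorphism, hence an embedding as M and N satisfy PA. *)
Lemma extension_compactness (T : theory) (M : structure) n (p : form n)
    (e : 'I_n -> M) :
  extends T PA -> models T M ->
  (forall l : seq (M * M * M * M),
     (forall a b c d, List.In (a, b, c, d) l -> (a * b + c)%A = d) ->
     exists (N : structure) (g : M -> N),
       [/\ models T N, g zeroS = zeroS, g oneS = oneS,
           forall a b c d, List.In (a, b, c, d) l -> (g a * g b + g c)%A = g d
         & sat (fun i => g (e i)) p]) ->
  exists (N : structure) (f : M -> N),
    [/\ embedding f, models T N & sat (fun i => f (e i)) p].
Proof.
move=> T_PA MT fin; have MPA := models_extends T_PA MT.
pose I := {l : seq (M * M * M * M) |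
  forall a b c d, List.In (a, b, c, d) l -> (a * b + c)%A = d}.
pose Y := {N : structure & M -> N}.
pose ok (i : I) (y : Y) := let h := projT2 y in
  [/\ models T (projT1 y), h zeroS = zeroS, h oneS = oneS,
      forall a b c d, List.In (a, b, c, d) (sval i) -> (h a * h b + h c)%A = h d
    & sat (fun j => h (e j)) p].
have [g gP] : {g : I -> Y & forall i, ok i (g i)}.
  by apply: choice => -[l lP]; have [N [h hP]] := fin l lP;
    exists (existT _ N h).
(* The filter of cones: an ultrafilter above it contains, for each equation true in [M], the set of
   finite lists including that equation. *)
pose F : set_system I :=
  fun A => exists l0 : I, forall l : I, List.incl (sval l0) (sval l) -> A l.
have FF : ProperFilter F.
  split; first by move=> [l0 /(_ l0 (fun _ => id))].
  split.
  - have nilP (a b c d : M) : List.In (a, b, c, d) [::] -> (a * b + c)%A = d.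
      by [].
    by exists (exist _ _ nilP : I).
  - move=> A B [[l lP] lA] [[l' l'P] lB].
    have catP (a b c d : M) : List.In (a, b, c, d) (l ++ l') -> (a * b + c)%A = d.
      by move=> H; case: (List.in_app_or _ _ _ H); [exact: lP|exact: l'P].
    exists (exist _ _ catP : I) => -[k kP] /= kl.
    split; [apply: lA|apply: lB] => x xl; apply: kl; apply: List.in_or_app.
      by left.
    by right.
  - by move=> A B AB [l lA]; exists l => k /lA/AB.
have [U [UU FU]] := ultraFilterLemma FF.
have Ufact a b c d : (a * b + c)%A = d ->
    U (fun i => (projT2 (g i) a * projT2 (g i) b + projT2 (g i) c)%A
                = projT2 (g i) d).
  move=> abcd; apply: FU.
  have aP (a' b' c' d' : M) : List.In (a', b', c', d') [:: (a, b, c, d)] ->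
      (a' * b' + c')%A = d'.
    by move=> [[<- <- <- <-]|[]].
  exists (exist _ _ aP : I) => i il.
  by have [_ _ _ + _] := gP i; apply; apply: il; left.
pose S i := projT1 (g i).
have NT : models T (ultraproduct UU S).
  by apply: models_ultraproduct => i; case: (gP i).
have SPA i : models PA (S i) by apply: models_extends T_PA _; case: (gP i).
pose f m : ultraproduct UU S := ultra_class UU (fun i => projT2 (g i) m).
exists (ultraproduct UU S), f; split=> //.
- apply: hom_embedding => //.
  + exact: models_extends NT.
  + by congr ultra_class; apply: functional_extensionality_dep => i;
      case: (gP i).
  + by congr ultra_class; apply: functional_extensionality_dep => i;
      case: (gP i).
  + move=> x y; rewrite ultra_classD; apply/ultra_class_eq.
    apply: filterS (@Ufact oneS x y (x + y)%A _) => [i|]; last by rewrite mul1x.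
    by case: (gP i) => _ _ -> _ _; rewrite (mul1x (SPA i)).
  + move=> x y; rewrite ultra_classM; apply/ultra_class_eq.
    apply: filterS (@Ufact x y zeroS (x * y)%A _) => [i|]; last by rewrite addx0.
    by case: (gP i) => _ -> _ _ _; rewrite (addx0 (SPA i)).
- apply/sat_ultraproduct; apply: filterS filterT => i _.
  by case: (gP i).
Qed.

(** * Coding arbitrary reals in extensions *)

Lemma finite_set_code (A : nat -> Prop) n :
  exists c, forall k, k < n -> odd (c %/ 2 ^ k) <-> A k.
Proof.
elim: n A => [|n IHn] A; first by exists 0.
have [c cP] := IHn (fun k => A k.+1).
exists (`[< A 0 >] + c.*2) => -[_|k kn].
  by rewrite divn1 oddD odd_double addbF oddb; split=> /asboolP.
rewrite -(cP k kn) expnS divnMA.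
by rewrite divn2 halfD odd_double andbF add0n doubleK; case: `[< _ >].
Qed.

(** In an ultrapower over an ultrafilter containing all cofinite sets, take the class of the
    sequence whose [n]-th term codes [A] below [n]: its digit of rank [k] is correct at every index
    [n > k]. *)
Lemma real_coded_in_extension (T : theory) (M : structure) (A : nat -> Prop) :
  extends T PA -> models T M ->
  exists (N : structure) (f : M -> N) (y : N),
    [/\ embedding f, models T N & coded_set y = A].
Proof.
move=> T_PA MT; have MPA := models_extends T_PA MT.
pose F : set_system nat := fun B => exists n, forall m, n <= m -> B m.
have FF : ProperFilter F.
  split; first by move=> [n /(_ n (leqnn n))].
  split.
  - by exists 0.
  - move=> B C [n nB] [m mC]; exists (maxn n m) => k.
    by rewrite geq_max => /andP[/nB ? /mC ?].
  - by move=> B C BC [n nB]; exists n => k /nB/BC.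
have [U [UU FU]] := ultraFilterLemma FF.
have [c cP] := choice (finite_set_code A).
pose N := ultraproduct UU (fun _ => M).
have NT : models T N by apply: models_ultraproduct.
have NPA := models_extends T_PA NT.
pose cls (h : nat -> M) : N := ultra_class UU (S := fun _ => M) h.
pose f m := cls (fun _ => m).
have fE : embedding f.
  by apply: hom_embedding => // [x y|x y]; rewrite ?ultra_classD ?ultra_classM.
exists N, f, (cls (fun n => num M (c n))); split=> //.
apply: funext => k; rewrite propeqE /coded_set -(embedding_num fE).
pose w n := scons (fun _ : nat => num M k) (scons (fun n => num M (c n)) snil) n.
have -> : scons (f (num M k)) (scons (cls (fun n => num M (c n))) snil) =
    fun j => ultra_class UU (w j).
  by rewrite /w !comp_scons; congr (scons _ (scons _ _)); apply/esym/snil_unique.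
rewrite sat_ultraproduct.
have kE n : k < n -> A k <-> sat (fun j => w j n) (mem_form x0 x1).
  by move=> kn; rewrite sat_mem /= /w !sconsE (mem_num_num MPA) cP.
split=> [H|Ak].
  have Uk : U (fun n => k < n) by apply: FU; exists k.+1.
  apply: contrapT => nAk; apply: (@filter_not_empty _ U).
  by apply: filterS2 Uk H => n kn /(kE _ kn).
by apply: FU; exists k.+1 => n kn; apply/(kE _ kn).
Qed.

(** * The standard cut *)

Notation x4 := (Var (lift ord0 (lift ord0 (lift ord0 (lift ord0 ord0))))).
Notation x5 :=
  (Var (lift ord0 (lift ord0 (lift ord0 (lift ord0 (lift ord0 ord0)))))).
Notation x6 := (Var (lift ord0
  (lift ord0 (lift ord0 (lift ord0 (lift ord0 (lift ord0 ord0))))))).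
Notation x7 := (Var (lift ord0 (lift ord0
  (lift ord0 (lift ord0 (lift ord0 (lift ord0 (lift ord0 ord0)))))))).
Notation x8 := (Var (lift ord0 (lift ord0 (lift ord0
  (lift ord0 (lift ord0 (lift ord0 (lift ord0 (lift ord0 ord0))))))))).
Notation x9 := (Var (lift ord0 (lift ord0 (lift ord0 (lift ord0
  (lift ord0 (lift ord0 (lift ord0 (lift ord0 (lift ord0 ord0)))))))))).

(** * Pairing, coded equations and the formula theta *)

Definition pair_nat (a b : nat) : nat := (a + b) * (a + b) + a.

(** The sum [a + b] is recovered as the integer square root of the code. *)
Lemma pair_nat_inj a b a' b' :
  pair_nat a b = pair_nat a' b' -> a = a' /\ b = b'.
Proof.
have le_sum a1 b1 a2 b2 : pair_nat a1 b1 = pair_nat a2 b2 -> a1 + b1 <= a2 + b2.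
  move=> H; rewrite leqNgt; apply/negP => lt12.
  have : pair_nat a2 b2 < pair_nat a1 b1.
    rewrite /pair_nat (@leq_trans ((a2 + b2).+1 * (a2 + b2).+1)) //.
      by rewrite mulSn mulnS; lia.
    by rewrite (leq_trans _ (leq_addr _ _)) // leq_mul.
  by rewrite H ltnn.
move=> H; have sumE : a + b = a' + b'.
  by apply/eqP; rewrite eqn_leq (le_sum _ _ _ _ H) (le_sum _ _ _ _ (esym H)).
move: H; rewrite /pair_nat sumE => /addnI aE.
by move: sumE; rewrite aE => /addnI.
Qed.

(** A polynomial pairing is itself a term, so it commutes with [num] in every model of PA. *)
Definition pair_term n (s t : term n) : term n :=
  Add (Mul (Add s t) (Add s t)) s.

Definition pairM (M : structure) (x y : M) : M := ((x + y) * (x + y) + x)%A.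

Lemma num_pair (M : structure) a b : models PA M ->
  num M (pair_nat a b) = pairM (num M a) (num M b).
Proof. by move=> MPA; rewrite /pair_nat !(numD, numM). Qed.

(* A fact (i, j, k, l) stands for the equation w_i * w_j + w_k = w_l between
   members of a sequence w starting with w_0 = 1 and w_1 = 0. *)
Definition fact : Type := (nat * nat * nat * nat)%type.

Definition realizes (M : structure) (w : nat -> M) (L : seq fact) : Prop :=
  forall i j k l, (i, j, k, l) \in L -> (w i * w j + w k)%A = w l.

Definition fact_code (p i j k l : nat) : nat :=
  pair_nat p (pair_nat i (pair_nat j (pair_nat k l))).

Lemma fact_code_inj p i j k l p' i' j' k' l' :
  fact_code p i j k l = fact_code p' i' j' k' l' ->
  p = p' /\ (i, j, k, l) = (i', j', k', l').
Proof.
by move=> /pair_nat_inj[-> /pair_nat_inj[-> /pair_nat_inj[-> /pair_nat_inj[-> ->]]]].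
Qed.

Definition fact_codeM (M : structure) (p i j k l : M) : M :=
  pairM p (pairM i (pairM j (pairM k l))).

Lemma num_fact_code (M : structure) p i j k l : models PA M ->
  num M (fact_code p i j k l) =
  fact_codeM (num M p) (num M i) (num M j) (num M k) (num M l).
Proof. by move=> MPA; rewrite /fact_code !num_pair. Qed.

Definition beta_factM (M : structure) (c d i j k l : M) : Prop :=
  forall x y z u, betaM c d i x -> betaM c d j y -> betaM c d k z ->
    betaM c d l u -> (x * y + z)%A = u.

(** The free variables 0 to 5 are [l], [k], [j], [i], [d], [c]; under the quantifiers they become
    [x4] to [x9], and [x3] to [x0] are the four values. *)
Definition beta_fact_form n : form n.+4.+2 :=
  All (All (All (All
    (Imp (beta_form x9 x8 x7 x3) (Imp (beta_form x9 x8 x6 x2)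
    (Imp (beta_form x9 x8 x5 x1) (Imp (beta_form x9 x8 x4 x0)
      (Equ (Add (Mul x3 x2) x1) x0)))))))).

(* Some sequence w with w_0 = 1, w_1 = 0, w_2 = v, w_3 = t satisfies all facts
   with indices at most p which t ascribes to p. *)
Definition realizableM (M : structure) (p v t : M) : Prop := exists c d,
  [/\ betaM c d (num M 0) 1%A, betaM c d (num M 1) 0%A,
      betaM c d (num M 2) v, betaM c d (num M 3) t &
      forall i j k l, (i < p + 1)%A -> (j < p + 1)%A -> (k < p + 1)%A ->
        (l < p + 1)%A -> memM (fact_codeM p i j k l) t ->
        beta_factM c d i j k l].

(** The free variables 0 to 4 are [d], [c], [p], [v], [t], which become [x4] to [x8]; the indices
    [i], [j], [k], [l] are [x3] to [x0]. *)
Definition realizable_facts_form n : form n.+3.+2 :=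
  All (All (All (All
    (Imp (Less x3 (Add x6 One)) (Imp (Less x2 (Add x6 One))
    (Imp (Less x1 (Add x6 One)) (Imp (Less x0 (Add x6 One))
    (Imp (mem_form (pair_term x6 (pair_term x3 (pair_term x2 (pair_term x1 x0))))
            x8)
      (beta_fact_form _))))))))).

Definition realizable_form : form 3 :=
  Ex (Ex (And (beta_form x1 x0 Zero One)
         (And (beta_form x1 x0 (Add Zero One) Zero)
         (And (beta_form x1 x0 (Add (Add Zero One) One) x3)
         (And (beta_form x1 x0 (Add (Add (Add Zero One) One) One) x4)
              (realizable_facts_form 0)))))).

Definition thetaM (M : structure) (v t : M) : Prop :=
  forall p, (p < v + 1)%A -> ~ realizableM p v t.

Definition theta_form : form 2 :=
  All (Imp (Less x0 (Add x1 One)) (Neg realizable_form)).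

Lemma sat_beta_fact (M : structure) n (e : 'I_n -> M) c d i j k l :
  sat (scons l (scons k (scons j (scons i (scons d (scons c e))))))
    (beta_fact_form n) <-> beta_factM c d i j k l.
Proof.
rewrite /beta_fact_form; split=> [/sat_All H x y z u|H].
  have /sat_All/(_ y)/sat_All/(_ z)/sat_All/(_ u) := H x.
  by rewrite 4!sat_Imp !sat_beta /= !sconsE.
apply/sat_All => x; apply/sat_All => y; apply/sat_All => z; apply/sat_All => u.
rewrite 4!sat_Imp !sat_beta /= !sconsE; exact: H.
Qed.

Lemma sat_realizable (M : structure) (p v t : M) :
  sat (scons p (scons v (scons t snil))) realizable_form <->
  realizableM p v t.
Proof.
have facts c d : sat (scons d (scons c (scons p (scons v (scons t snil)))))
    (realizable_facts_form 0) <->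
    forall i j k l, (i < p + 1)%A -> (j < p + 1)%A -> (k < p + 1)%A ->
      (l < p + 1)%A -> memM (fact_codeM p i j k l) t ->
      beta_factM c d i j k l.
  rewrite /realizable_facts_form; split=> [/sat_All H i j k l|H].
    have /sat_All/(_ j)/sat_All/(_ k)/sat_All/(_ l) := H i.
    by rewrite 5!sat_Imp sat_mem sat_beta_fact /= !sconsE.
  apply/sat_All => i; apply/sat_All => j; apply/sat_All => k; apply/sat_All => l.
  rewrite 5!sat_Imp sat_mem sat_beta_fact /= !sconsE; exact: H.
have matrix c d : sat (scons d (scons c (scons p (scons v (scons t snil)))))
    (And (beta_form x1 x0 Zero One)
         (And (beta_form x1 x0 (Add Zero One) Zero)
         (And (beta_form x1 x0 (Add (Add Zero One) One) x3)
         (And (beta_form x1 x0 (Add (Add (Add Zero One) One) One) x4)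
              (realizable_facts_form 0))))) <->
  [/\ betaM c d (num M 0) 1%A, betaM c d (num M 1) 0%A,
      betaM c d (num M 2) v, betaM c d (num M 3) t &
      forall i j k l, (i < p + 1)%A -> (j < p + 1)%A -> (k < p + 1)%A ->
        (l < p + 1)%A -> memM (fact_codeM p i j k l) t ->
        beta_factM c d i j k l].
  rewrite 4!sat_And facts !sat_beta /= !sconsE.
  by split=> [[? [? [? []]]]|[]].
split=> [/sat_Ex[c /sat_Ex[d /matrix H]]|[c [d H]]]; first by exists c, d.
by apply/sat_Ex; exists c; apply/sat_Ex; exists d; apply/matrix.
Qed.

Lemma sat_theta (M : structure) (v t : M) :
  sat (scons v (scons t snil)) theta_form <-> thetaM v t.
Proof.
have matrix p : sat (scons p (scons v (scons t snil)))
    (Imp (Less x0 (Add x1 One)) (Neg realizable_form)) <->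
    ((p < v + 1)%A -> ~ realizableM p v t).
  by rewrite 2!sat_Imp sat_realizable /= !sconsE.
by rewrite sat_All; split=> H p; apply/matrix; apply: H.
Qed.

Lemma sat_not_theta (M N : structure) (f : M -> N) (v t : M) :
  sat (fun i => f (scons v (scons t snil) i)) (Neg theta_form) <->
  ~ thetaM (f v) (f t).
Proof.
by rewrite !comp_scons (snil_unique (fun i => f (snil i))) sat_Imp sat_theta.
Qed.

(** * Modal definability of the standard cut *)

Section StandardCut.
Variables (T : theory) (T_PA : extends T PA).

Definition good (L : seq fact) : Prop :=
  forall N : structure, models T N -> forall w : nat -> N,
    w 0 = 1%A -> w 1 = 0%A -> realizes w L -> thetaM (w 2) (w 3).

(** [realizableM] at [p] inspects only indices up to [p]; under this bound it sees the whole
    list. *)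
Definition bounded_facts (p : nat) (L : seq fact) : Prop :=
  forall i j k l, (i, j, k, l) \in L -> [/\ i <= p, j <= p, k <= p & l <= p].

(** The list is read from entry 1 of the decoded sequence; entry 0 is padding that lets [p] be made
    as large as the indices in the list. *)
Definition decode_facts (p : nat) : seq fact :=
  odflt [::] (unpickle (nth 0 (CodeSeq.decode p) 1)).

(* The equation (0, 0, 0, 0), that is 1 * 1 + 1 = 1, is not realizable. *)
Definition facts (p : nat) : seq fact :=
  if `[< good (decode_facts p) /\ bounded_facts p (decode_facts p) >]
  then decode_facts p else [:: (0, 0, 0, 0)].

(** This real may be far from computable, as [good] quantifies over all models of [T]; it suffices
    that every real is coded in some extension. *)
Definition good_facts : nat -> Prop := fun n =>
  exists p i j k l, n = fact_code p i j k l /\ (i, j, k, l) \in facts p.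

Lemma good_facts_code p i j k l :
  good_facts (fact_code p i j k l) <-> (i, j, k, l) \in facts p.
Proof.
split=> [[p' [i' [j' [k' [l' [/fact_code_inj[-> ->]//]]]]]]|H].
by exists p, i, j, k, l.
Qed.

Lemma encode_facts (L : seq fact) : good L ->
  exists p, facts p = L /\ bounded_facts p L.
Proof.
move=> Lgood; have [B LB] : exists B, bounded_facts B L.
  elim: L {Lgood} => [|[[[i j] k] l] L [B LB]]; first by exists 0.
  exists (i + j + k + l + B) => i' j' k' l'; rewrite in_cons.
  by move=> /orP[/eqP[-> -> -> ->]|/LB[]]; split; lia.
pose p := CodeSeq.code [:: B; pickle L].
(* The code of a sequence starting with [B] is a nonzero multiple of [2 ^ B], hence larger than
   [B]. *)
have Bp : B <= p.
  rewrite (leq_trans (ltnW (ltn_expl B (ltnSn 1)))) // /p /= -{1}(muln1 (2 ^ B)).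
  by rewrite leq_mul2l orbT.
have Lp : bounded_facts p L.
  by move=> i j k l /LB[iB jB kB lB]; split; apply: leq_trans Bp.
exists p; split=> //; rewrite /facts.
have -> : decode_facts p = L.
  by rewrite /decode_facts CodeSeq.codeK -[nth _ _ _]/(pickle L) pickleK.
by rewrite asboolT.
Qed.

Lemma coded_good_facts (M : structure) (t : M) p i j k l :
  models PA M -> coded_set t = good_facts ->
  memM (fact_codeM (num M p) (num M i) (num M j) (num M k) (num M l)) t <->
  (i, j, k, l) \in facts p.
Proof.
by move=> MPA tE; rewrite -num_fact_code // -coded_setE tE good_facts_code.
Qed.

(* If theta failed at a standard n, the witness p <= n would be standard and
   its facts realized, but then they are good facts and imply theta. *)
Lemma theta_standard (M : structure) (t : M) n :
  models T M -> coded_set t = good_facts -> thetaM (num M n) t.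
Proof.
move=> MT tE p; have MPA := models_extends T_PA MT.
move=> /(less_num MPA (k := n.+1))[q qn ->] qreal.
have [c [d [c0 c1 c2 c3 cF]]] := qreal.
have [w wP] := choice (fun i => beta_total MPA c d (num M i)).
have w0 := beta_unique MPA (wP 0) c0; have w1 := beta_unique MPA (wP 1) c1.
have w2 := beta_unique MPA (wP 2) c2; have w3 := beta_unique MPA (wP 3) c3.
have fact_eq i j k l : i <= q -> j <= q -> k <= q -> l <= q ->
    (i, j, k, l) \in facts q -> (w i * w j + w k)%A = w l.
  move=> iq jq kq lq /(coded_good_facts _ _ _ _ _ MPA tE) tF.
  have lt_num m : m <= q -> (num M m < num M q + 1)%A.
    by move=> mq; apply/(num_less MPA m q.+1).
  by apply: (cF _ _ _ _ _ _ _ _ tF (w i) (w j) (w k) (w l)); auto.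
move: fact_eq; rewrite /facts; case: asboolP => [[Lgood Lq] fact_eq|_ fact_eq].
  have : thetaM (w 2) (w 3).
    apply: Lgood => // i j k l ijkl.
    by have [iq jq kq lq] := Lq _ _ _ _ ijkl; apply: fact_eq.
  rewrite w2 w3 => /(_ (num M q)) nreal; apply: nreal qreal.
  exact/(num_less MPA q n.+1).
have := fact_eq 0 0 0 0 isT isT isT isT isT; rewrite w0 (mul1x MPA) => H.
by apply: (@add_succ_neq M MPA 1%A 0%A); rewrite (add0x MPA).
Qed.

Lemma index_In (M : structure) (s : seq M) x : List.In x s ->
  exists i, nth 0%A s i = x.
Proof.
elim: s => //= y s IHs [->|/IHs[i <-]]; first by exists 0.
by exists i.+1.
Qed.

Lemma mem_mapP_In (X : Type) (Y : eqType) (f : X -> Y) (s : seq X) y :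
  y \in map f s <-> exists2 x, List.In x s & y = f x.
Proof.
elim: s => [|x s IHs] /=; first by split=> // -[].
rewrite in_cons; split=> [/orP[/eqP->|/IHs[z zs ->]]|[z [<- ->|zs yE]]].
- by exists x => //; left.
- by exists z => //; right.
- by rewrite eqxx.
- by apply/orP; right; apply/IHs; exists z.
Qed.

(** If compactness fails at a finite list [L], then [L] yields a good list of facts, which belongs
    to some standard [p] below [x]. The elements of [M] themselves realize it, against theta in
    [M]. *)
Lemma theta_nonstandard (M : structure) (t x : M) :
  models T M -> coded_set t = good_facts -> (forall k, x <> num M k) ->
  exists (N : structure) (f : M -> N),
    [/\ embedding f, models T N & ~ thetaM (f x) (f t)].
Proof.
move=> MT tE xns; have MPA := models_extends T_PA MT.
have [|N [f [fE NT nth]]] := @extension_compactness T M 2 (Neg theta_form)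
    (scons x (scons t snil)) T_PA MT; last first.
  by exists N, f; split=> //; apply/sat_not_theta.
move=> L LM; apply: contrapT => nN.
have L_theta (N : structure) (g : M -> N) :
    models T N -> g 0%A = 0%A -> g 1%A = 1%A ->
    (forall a b c d, List.In (a, b, c, d) L -> (g a * g b + g c)%A = g d) ->
    thetaM (g x) (g t).
  move=> NT g0 g1 gL; apply: contrapT => nth; apply: nN; exists N, g; split=> //.
  exact/sat_not_theta.
(* The sequence lists the four prescribed values, then every element occurring in [L]. *)
pose s := [:: 1%A; 0%A; x; t] ++
  List.flat_map (fun u => [:: u.1.1.1; u.1.1.2; u.1.2; u.2]) L.
pose w i := nth 0%A s i.
have [ix ixP] : {ix : M -> nat & forall m, List.In m s -> w (ix m) = m}.
  apply: (choice (P := fun m i => List.In m s -> w i = m)) => m.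
  have [/index_In[i <-]|nms] := pselect (List.In m s).
    by exists i.
  by exists 0.
have sL a b c d : List.In (a, b, c, d) L ->
    [/\ List.In a s, List.In b s, List.In c s & List.In d s].
  move=> abcd; have sL m : List.In m [:: a; b; c; d] -> List.In m s.
    move=> mP; do 4 right; apply/List.in_flat_map.
    by exists (a, b, c, d).
  by split; apply: sL => /=; auto.
(* An element may occur at several places of [s]. The first four facts, of the form
   [1 * 0 + w_(ix m) = w_i], tie the index chosen for 1, 0, [x], [t] to its prescribed place. *)
pose L' : seq fact := [:: (0, 1, ix 1%A, 0); (0, 1, ix 0%A, 1); (0, 1, ix x, 2);
    (0, 1, ix t, 3)] ++ [seq (ix u.1.1.1, ix u.1.1.2, ix u.1.2, ix u.2) | u <- L].
have L'w : realizes w L'.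
  have e0 : (1 * 0 = 0 :> M)%A := mulx0 MPA _.
  move=> i j k l; rewrite /L' !in_cons => /or4P[|||/orP[|]].
  - by move=> /eqP[-> -> -> ->]; rewrite ixP /w /= ?e0 ?add0x //; left.
  - by move=> /eqP[-> -> -> ->]; rewrite ixP /w /= ?e0 ?add0x //; right; left.
  - by move=> /eqP[-> -> -> ->]; rewrite ixP /w /= ?e0 ?add0x //; do 2 right; left.
  - by move=> /eqP[-> -> -> ->]; rewrite ixP /w /= ?e0 ?add0x //; do 3 right; left.
  - move=> /mem_mapP_In[[[[a b] c] d] abcd [-> -> -> ->]].
    by have [sa sb sc sd] := sL _ _ _ _ abcd; rewrite !ixP //; apply: LM.
(* A realization [w'] of [L'] in [N] induces the map sending [m] to [w' (ix m)], to which [L_theta]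
   applies. *)
have L'good : good L'.
  move=> N NT w' w'0 w'1 w'L; have NPA := models_extends T_PA NT.
  have e0 : (1 * 0 = 0 :> N)%A := mulx0 NPA _.
  have ixE i m : (0, 1, ix m, i) \in L' -> w' (ix m) = w' i.
    by move=> /w'L <-; rewrite w'0 w'1 e0 (add0x NPA).
  have g1 : w' (ix 1%A) = w' 0 by apply: ixE; rewrite /L' !inE eqxx.
  have g0 : w' (ix 0%A) = w' 1 by apply: ixE; rewrite /L' !inE eqxx !orbT.
  have gx : w' (ix x) = w' 2 by apply: ixE; rewrite /L' !inE eqxx !orbT.
  have gt : w' (ix t) = w' 3 by apply: ixE; rewrite /L' !inE eqxx !orbT.
  rewrite -gx -gt; apply: (L_theta N (fun m => w' (ix m))) => //.
  - by rewrite g0.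
  - by rewrite g1.
  - move=> a b c d abcd; apply: w'L; rewrite mem_cat; apply/orP; right.
    by apply/mem_mapP_In; exists (a, b, c, d).
have [p [pE pL]] := encode_facts L'good.
(* The equations of [L] are true in [M], so the identity map qualifies. *)
have xt : thetaM x t by apply: (L_theta M id).
apply: (xt (num M p)).
  apply: (less_trans MPA (num_less_nonstandard MPA p xns)).
  by apply/(less_succ MPA); right.
(* The length covers both the four prescribed places and all indices up to [p]. *)
have [c [d cd]] := beta_seq MPA (maxn p 3) w.
have le3 i : i <= 3 -> betaM c d (num M i) (w i).
  by move=> i3; apply: cd; rewrite leq_max i3 orbT.
exists c, d; split; [exact: (le3 0)|exact: (le3 1)|exact: (le3 2)|exact: (le3 3)|].
have lt_num y : (y < num M p + 1)%A ->
    exists i, y = num M i /\ betaM c d (num M i) (w i).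
  move=> /(less_num MPA (k := p.+1))[i ip ->]; exists i; split=> //.
  by apply: cd; rewrite leq_max -ltnS ip.
move=> _ _ _ _ /lt_num[i [-> ci]] /lt_num[j [-> cj]] /lt_num[k [-> ck]]
  /lt_num[l [-> cl]] /(coded_good_facts _ _ _ _ _ MPA tE).
rewrite pE => /L'w wE y1 y2 y3 y4 /(beta_unique MPA ci)<- /(beta_unique MPA cj)<-.
by move=> /(beta_unique MPA ck)<- /(beta_unique MPA cl)<-.
Qed.

Definition box_thetaM (M : structure) (x t : M) : Prop :=
  forall (N : structure) (f : M -> N), embedding f -> models T N ->
    thetaM (f x) (f t).

Lemma box_thetaM_standard (M : structure) (x t : M) :
  models T M -> coded_set t = good_facts ->
  box_thetaM x t <-> exists k, x = num M k.
Proof.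
move=> MT tE; have MPA := models_extends T_PA MT; split=> [xt|[k ->] N f fE NT].
  apply: contrapT => xns.
  have [k xk|N [f [fE NT]]] := theta_nonstandard MT tE (x := x).
    by apply: xns; exists k.
  by apply; apply: xt.
rewrite (embedding_num fE); apply: theta_standard => //.
by rewrite (embedding_coded_set _ MPA (models_extends T_PA NT)).
Qed.

Lemma psat_PImp (M : structure) n (e : 'I_n -> M) p q :
  psat T e (PImp p q) <-> (psat T e p -> psat T e q).
Proof. by []. Qed.

Lemma psat_PAll (M : structure) n (e : 'I_n -> M) p :
  psat T e (PAll p) <-> forall x, psat T (scons x e) p.
Proof. by []. Qed.

Definition box_theta n (s t : term n) : pform n :=
  Box (PArith (subst (scons s (scons t snil)) theta_form)).

Lemma psat_box_theta (M : structure) n (e : 'I_n -> M) s t :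
  psat T e (box_theta s t) <-> box_thetaM (eval e s) (eval e t).
Proof.
have thetaE (N : structure) (f : M -> N) : embedding f ->
    sat (fun i => f (e i)) (subst (scons s (scons t snil)) theta_form) <->
    thetaM (f (eval e s)) (f (eval e t)).
  move=> fE; rewrite sat_subst !comp_scons -!(embedding_eval fE).
  by rewrite (snil_unique (fun i => eval _ _)) sat_theta.
by split=> H N f fE NT; apply/(thetaE _ _ fE)/H.
Qed.

(* x belongs to each of the possibly external sets { y | Box theta(y, t) },
   for t in an extension, that contains 0 and is closed under successor. *)
Definition standard n (x : 'I_n) : pform n :=
  Box (PAll (PImp (box_theta Zero x0)
    (PImp (PAll (PImp (box_theta x0 x1) (box_theta (Add x0 One) x1)))
          (box_theta (Var (lift ord0 x)) x0)))).

Lemma psat_standard (M : structure) n (e : 'I_n -> M) (x : 'I_n) :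
  models T M -> psat T e (standard x) <-> exists k, e x = num M k.
Proof.
move=> MT; have MPA := models_extends T_PA MT.
have matrix (N : structure) (f : M -> N) (t : N) :
    psat T (scons t (fun i => f (e i))) (PImp (box_theta Zero x0)
      (PImp (PAll (PImp (box_theta x0 x1) (box_theta (Add x0 One) x1)))
            (box_theta (Var (lift ord0 x)) x0))) <->
    (box_thetaM 0%A t ->
     (forall y, box_thetaM y t -> box_thetaM (y + 1)%A t) ->
     box_thetaM (f (e x)) t).
  have step : psat T (scons t (fun i => f (e i)))
        (PAll (PImp (box_theta x0 x1) (box_theta (Add x0 One) x1))) <->
      (forall y, box_thetaM y t -> box_thetaM (y + 1)%A t).
    have y_box y : psat T (scons y (scons t (fun i => f (e i)))) (box_theta x0 x1)
        <-> box_thetaM y t by rewrite psat_box_theta /= !sconsE.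
    have yS_box y : psat T (scons y (scons t (fun i => f (e i))))
        (box_theta (Add x0 One) x1) <-> box_thetaM (y + 1)%A t.
      by rewrite psat_box_theta /= !sconsE.
    by split=> H y /y_box yt; apply/yS_box/H.
  have zero_box : psat T (scons t (fun i => f (e i))) (box_theta Zero x0) <->
      box_thetaM 0%A t by rewrite psat_box_theta /= !sconsE.
  have x_box : psat T (scons t (fun i => f (e i)))
      (box_theta (Var (lift ord0 x)) x0) <-> box_thetaM (f (e x)) t.
    by rewrite psat_box_theta /= !sconsE.
  by split=> H /zero_box t0 /step tS; apply/x_box/H.
split=> [H|[k xk] N f fE NT t].
  (* For [t] coding [good_facts], the set of all [y] for which theta is necessary is exactly the
     standard cut of [N], so both closure premises hold; standardness then descends along the
     injective [f]. *)
  have [N [f [t [fE NT tE]]]] := real_coded_in_extension good_facts T_PA MT.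
  have /(box_thetaM_standard _ NT tE)[k fxk] : box_thetaM (f (e x)) t.
    apply: (matrix N f t).1 (H N f fE NT t) _ _ => [|y].
      by apply/(box_thetaM_standard _ NT tE); exists 0.
    by rewrite !(box_thetaM_standard _ NT tE) => -[k ->]; exists k.+1.
  by exists k; apply: (emb_inj fE); rewrite (embedding_num fE).
apply/matrix => th0 thS; rewrite xk (embedding_num fE).
by elim: k {xk} => //= k IHk; apply: thS.
Qed.

(** * The translation *)

(** Both sorts of variables land in the single sort of elements; [nu] and [sg] record where. Set
    quantifiers need no relativization, since every element codes some real. *)
Fixpoint translate n m (p : sform n m) :
    forall K, ('I_n -> 'I_K) -> ('I_m -> 'I_K) -> pform K :=
  match p with
  | SBot => fun K nu sg => PArith Bot
  | SEqu s t => fun K nu sg =>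
      PArith (Equ (subst_term (fun i => Var (nu i)) s)
                  (subst_term (fun i => Var (nu i)) t))
  | SLess s t => fun K nu sg =>
      PArith (Less (subst_term (fun i => Var (nu i)) s)
                   (subst_term (fun i => Var (nu i)) t))
  | SIn t X => fun K nu sg =>
      PArith (mem_form (subst_term (fun i => Var (nu i)) t) (Var (sg X)))
  | SImp p q => fun K nu sg => PImp (translate p nu sg) (translate q nu sg)
  | SAllNum p => fun K nu sg =>
      PAll (PImp (standard ord0)
        (translate p (scons ord0 (fun i => lift ord0 (nu i)))
                     (fun j => lift ord0 (sg j))))
  | SAllSet p => fun K nu sg =>
      Box (PAll (translate p (fun i => lift ord0 (nu i))
                             (scons ord0 (fun j => lift ord0 (sg j)))))
  end.

Lemma eval_num (M : structure) K n (e : 'I_K -> M) (en : 'I_n -> natS)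
    (nu : 'I_n -> 'I_K) t :
  models PA M -> (forall i, e (nu i) = num M (en i)) ->
  eval e (subst_term (fun i => Var (nu i)) t) = num M (eval en t).
Proof.
move=> MPA enu; elim: t => //= [|t1 -> t2 ->|t1 -> t2 ->].
- by rewrite (add0x MPA).
- by rewrite (numD MPA).
- by rewrite (numM MPA).
Qed.

(** The invariant is that number variables hold numerals and set variables hold codes. Embeddings
    preserve both, so the induction can move to extensions, with [M] generalized. *)
Lemma psat_translate n m (p : sform n m) K (nu : 'I_n -> 'I_K)
    (sg : 'I_m -> 'I_K) (M : structure) (e : 'I_K -> M) (en : 'I_n -> natS)
    (E : 'I_m -> nat -> Prop) :
  models T M -> (forall i, e (nu i) = num M (en i)) ->
  (forall j, coded_set (e (sg j)) = E j) ->
  ssat en E p <-> psat T e (translate p nu sg).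
Proof.
elim: p K nu sg M e en E => {n m} [n m|n m s t|n m s t|n m t X|n m p IHp q IHq
  |n m p IHp|n m p IHp] K nu sg M e en E MT enu esg;
  have MPA := models_extends T_PA MT.
- by [].
- rewrite /= !(eval_num _ MPA enu); split=> [->//|]; exact: num_inj.
- by rewrite /= !(eval_num _ MPA enu) (num_less MPA).
- change (E X (eval en t) <->
    sat e (mem_form (subst_term (fun i => Var (nu i)) t) (Var (sg X)))).
  by rewrite sat_mem (eval_num _ MPA enu) -coded_setE esg.
- by rewrite /= (IHp K nu sg M e) // (IHq K nu sg M e).
- split=> [H|/psat_PAll H k].
    apply/psat_PAll => x; apply/psat_PImp => /(psat_standard _ _ MT)[k].
    rewrite sconsE => xk; apply/(IHp _ _ _ _ _ (scons k en) E) => // i.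
      by case: (unliftP ord0 i) => [j ->|->]; rewrite !sconsE.
    by rewrite sconsE.
  apply/(IHp _ (scons ord0 (fun i => lift ord0 (nu i)))
           (fun j => lift ord0 (sg j)) M (scons (num M k) e)) => // [i|j|].
  + by case: (unliftP ord0 i) => [j ->|->]; rewrite !sconsE.
  + by rewrite sconsE.
  + by apply: H; apply/(psat_standard _ _ MT); exists k; rewrite sconsE.
- split=> [H N f fE NT|H A].
    apply/psat_PAll => y.
    apply/(IHp _ _ _ _ _ en (scons (coded_set y) E)) => // [i|j].
      by rewrite sconsE enu (embedding_num fE).
    case: (unliftP ord0 j) => [i ->|->]; rewrite !sconsE //.
    by rewrite (embedding_coded_set _ MPA (models_extends T_PA NT)).
  (* [A] may have no code in [M]; the box permits going to an extension that has one. *)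
  have [N [f [y [fE NT yA]]]] := real_coded_in_extension A T_PA MT.
  apply/(IHp _ (fun i => lift ord0 (nu i))
    (scons ord0 (fun j => lift ord0 (sg j))) N (scons y (fun i => f (e i))))
    => // [i|j|].
  + by rewrite sconsE enu (embedding_num fE).
  + case: (unliftP ord0 j) => [i ->|->]; rewrite !sconsE //.
    by rewrite (embedding_coded_set _ MPA (models_extends T_PA NT)).
  + exact: H.
Qed.
End StandardCut.

Theorem theorem10 (T : theory) (T_ce : ce_theory T) (T_con : consistent T)
    (T_PA : extends T PA) (phi : sform 0 1) :
  exists phi_star : pform 1,
    forall M : structure, models T M ->
    forall a : nat -> Prop, SSy M a ->
    forall abar : M, codes abar a ->
      (ssat snil (scons a snil) phi <-> psat T (scons abar snil) phi_star).
Proof.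
(* The formula has no free number variable, and its only set variable is sent to the place of
   [abar]. *)
exists (translate phi snil id) => M MT a _ abar aE.
apply: psat_translate => // [[]//|j].
apply: funext => k; rewrite propeqE.
by case: (unliftP ord0 j) => [[]//|->]; rewrite !sconsE aE.
Qed.
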